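(* For all $\rho\in[1,\frac{e}{e-1}]$, $\tau\ge0$ and $\widehat\mu<\mu_\tau(\rho)$, there exists no randomized ski rental algorithm (with $\alpha=\beta=1$) that is $(\rho,\widehat\mu)$-competitive for ski rental instances with prediction $\tau$, i.e., for every such algorithm there is a season length $\ell\ge0$ for which its expected cost exceeds $\rho\min\{\ell,1\}+\widehat\mu|\tau-\ell|$.
   Context: Ski rental with $\alpha=\beta=1$: given a prediction $\tau\ge0$ of the unknown season length $\ell\ge0$, a randomized algorithm chooses a random buying time $A\in[0,\infty]$ (depending only on $\tau$); its cost is $1+A$ if $A<\ell$ and $\ell$ otherwise. For $\tau\le1$, $\mu_\tau(\rho)=-\frac{\rho-1}{1-\tau}+\rho e^{\tau-1}$ if $(1-\tau)e^{\tau-1}>2-\frac2\rho$, and $\mu_\tau(\rho)=\frac{e^{\tau}(1-\rho\frac{e-1}{e})}{2-(1-\tau)e^{\tau}}$ if $(1-\tau)e^{\tau-1}\le2-\frac2\rho$. For $\tau>1$, $\mu_\tau(\rho)=\min\{\mu\mid (\mu,T)\in M_\tau(\rho)\text{ for some }T\}$, where $M_\tau(\rho)$ is the set of pairs $(\mu,T)\in\mathbb{R}^2$ satisfying $\rho\tau+(T-\tau)(\mu\tau+\rho-\mu-1)e^T\le\rho$ and $\rho-2\mu\le(\mu\tau+\rho-\mu-1)e^T\le\rho-\mu$. *)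

(* Defs.v *)
From HB Require Import structures.
From mathcomp Require Import all_boot all_order all_algebra.
From mathcomp Require Import all_classical all_reals all_analysis.
From mathcomp Require Import measurable_realfun.
From mathcomp Require Import ring lra.

Set Implicit Arguments.
Unset Strict Implicit.
Unset Printing Implicit Defensive.

Import Order.TTheory GRing.Theory Num.Theory.
Import numFieldNormedType.Exports.

Local Open Scope classical_set_scope.
Local Open Scope ring_scope.

Section SkiRental.
Context {R : realType}.

(* The buying time [a] ranges over [0, +oo]; [a = +oo] means never buying. *)
Definition ski_cost (l : R) (a : \bar R) : \bar R :=
  if (a < l%:E)%E then (1 + a)%E else l%:E.

Definition expected_cost (d : measure_display) (Omega : measurableType d)
    (P : probability Omega R) (A : Omega -> \bar R) (l : R) : \bar R :=
  (\int[P]_w ski_cost l (A w))%E.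

(* For tau = 1 the condition is false (as rho >= 1), so the quotient by
   1 - tau is only used for tau < 1. *)
Definition mu_le1 (tau rho : R) : R :=
  if (1 - tau) * expR (tau - 1) > 2 - 2 / rho then
    - ((rho - 1) / (1 - tau)) + rho * expR (tau - 1)
  else
    expR tau * (1 - rho * ((expR 1 - 1) / expR 1)) /
      (2 - (1 - tau) * expR tau).

Definition M (tau rho : R) : set (R * R) :=
  [set p | let: (mu, T) := p in
    [/\ rho * tau + (T - tau) * (mu * tau + rho - mu - 1) * expR T <= rho,
        rho - 2 * mu <= (mu * tau + rho - mu - 1) * expR T
      & (mu * tau + rho - mu - 1) * expR T <= rho - mu]].

Definition is_min (S : set R) (m : R) : Prop := S m /\ lbound S m.

(* The minimum of S; the default value 0 is only taken if S has no minimum. *)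
Definition minimum (S : set R) : R := xget 0 (is_min S).

Definition mu_gt1 (tau rho : R) : R :=
  minimum [set mu | exists T, M tau rho (mu, T)].

Definition mu (tau rho : R) : R :=
  if tau <= 1 then mu_le1 tau rho else mu_gt1 tau rho.

Lemma minimumP (S : set R) : (exists m, is_min S m) -> is_min S (minimum S).
Proof. by move=> ex; exact: xgetPex ex. Qed.

Lemma M_bounds (tau rho m T : R) : 1 < tau -> 1 <= rho -> M tau rho (m, T) ->
  m <= 1 ->
  [/\ 0 <= m, T <= tau
    & - (4 * tau * (tau + rho)) / (rho * (tau - 1)) <= T].
Proof.
move=> tau1 rho1 [].
set c := m * tau + rho - m - 1.
have E0 := expR_gt0 T => h1 h2 h3 m1.
have m0 : 0 <= m by lra.
have c0 : 0 <= c by rewrite /c; nra.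
have cle : c <= tau + rho by rewrite /c; nra.
have Tt : T <= tau.
  rewrite leNgt; apply/negP => tT.
  have : 0 <= (T - tau) * c * expR T by apply: mulr_ge0; [apply: mulr_ge0; lra|exact: ltW].
  nra.
split=> //.
have D0 : 0 < rho * (tau - 1) by nra.
rewrite ler_pdivrMr //.
have [T0|T0] := leP 0 T; first by nra.
pose s := - T / 2.
have s0 : 0 < s by rewrite /s; lra.
have es : 1 + s <= expR s by exact: expR_ge1Dx.
have eT : expR T * (expR s * expR s) = 1.
  by rewrite -!expRD -[RHS]expR0; congr expR; rewrite /s; lra.
have e1 : expR T * ((1 + s) * (1 + s)) <= 1.
  by rewrite -eT; apply: ler_wpM2l; [exact: ltW|apply: ler_pM; lra].
have TE : T = - 2 * s by rewrite /s; lra.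
have h4 : rho * (tau - 1) <= 2 * tau * (1 + s) * c * expR T.
  apply: (@le_trans _ _ ((tau - T) * c * expR T)); first by lra.
  apply: ler_wpM2r; first exact: ltW.
  by apply: ler_wpM2r => //; rewrite TE; nra.
have h5 : rho * (tau - 1) * (1 + s) <= 2 * tau * c.
  apply: (@le_trans _ _ (2 * tau * (1 + s) * c * expR T * (1 + s))).
    by rewrite ler_wpM2r //; lra.
  have -> : 2 * tau * (1 + s) * c * expR T * (1 + s) =
            2 * tau * c * (expR T * ((1 + s) * (1 + s))) by ring.
  by rewrite -[leRHS]mulr1 ler_wpM2l // !mulr_ge0 //; lra.
have h6 : tau * c <= tau * (tau + rho) by rewrite ler_wpM2l //; lra.
rewrite TE; nra.
Qed.

Lemma mu_gt1P (tau rho : R) : 1 < tau -> 1 <= rho ->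
  is_min [set m | exists T, M tau rho (m, T)] (mu_gt1 tau rho).
Proof.
move=> tau1 rho1; apply: minimumP.
pose B := - (4 * tau * (tau + rho)) / (rho * (tau - 1)).
pose K := (`[0, 1] `*` `[B, tau]) `&` M tau rho.
have MK m T : M tau rho (m, T) -> m <= 1 -> K (m, T).
  move=> MT m1; split=> //; have [m0 Tt BT] := M_bounds tau1 rho1 MT m1.
  by split; rewrite /= in_itv /= ?m0 ?m1 ?Tt ?BT.
have M0 : M tau rho (tau^-1, 0).
  have tV : tau^-1 * tau = 1 by rewrite mulVf //; lra.
  have tV0 : 0 < tau^-1 by rewrite invr_gt0; lra.
  by rewrite /M /= expR0 tV; split; nra.
have tV1 : tau^-1 <= 1 by rewrite invf_le1 //; lra.
have cf : continuous (fun p : R * R => p.1) by move=> p; exact: cvg_fst.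
have cs : continuous (fun p : R * R => p.2) by move=> p; exact: cvg_snd.
pose c (p : R * R) := p.1 * tau + rho - p.1 - 1.
have cc : continuous c.
  move=> p; apply: cvgB; last exact: cvg_cst.
  apply: cvgB; last exact: cf.
  apply: cvgD; last exact: cvg_cst.
  by apply: cvgM; [exact: cf|exact: cvg_cst].
have ce : continuous (fun p : R * R => expR p.2).
  by move=> p; apply: continuous_comp; [exact: cs|exact: continuous_expR].
pose f1 (p : R * R) := rho * tau + (p.2 - tau) * c p * expR p.2.
have cf1 : continuous f1.
  move=> p; apply: cvgD; first exact: cvg_cst.
  apply: cvgM; last exact: ce.
  apply: cvgM; last exact: cc.
  by apply: cvgB; [exact: cs|exact: cvg_cst].
pose f2 (p : R * R) := c p * expR p.2 - (rho - 2 * p.1).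
have cce p : (c q * expR q.2) @[q --> p] --> c p * expR p.2.
  by apply: cvgM; [exact: cc|exact: ce].
have cf2 : continuous f2.
  move=> p; apply: cvgB; first exact: cce.
  apply: cvgB; first exact: cvg_cst.
  by apply: cvgM; [exact: cvg_cst|exact: cf].
pose f3 (p : R * R) := c p * expR p.2 - (rho - p.1).
have cf3 : continuous f3.
  move=> p; apply: cvgB; first exact: cce.
  by apply: cvgB; [exact: cvg_cst|exact: cf].
have Mclosed : closed (M tau rho).
  have -> : M tau rho = (f1 @^-1` [set x | x <= rho]) `&`
      ((f2 @^-1` [set x | 0 <= x]) `&` (f3 @^-1` [set x | x <= 0])).
    apply/seteqP; split=> -[m T] /=.
      by move=> [h1 h2 h3]; rewrite /f2 /f3 /c /= subr_ge0 subr_le0.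
    by move=> [h1]; rewrite /f2 /f3 /c /= subr_ge0 subr_le0 => -[].
  apply: closedI; last apply: closedI.
  - by apply: preimage_closed => [p _|]; [exact: cf1|exact: closed_le].
  - by apply: preimage_closed => [p _|]; [exact: cf2|exact: closed_ge].
  - by apply: preimage_closed => [p _|]; [exact: cf3|exact: closed_le].
have Kcpt : compact K.
  have boxc : compact (`[0, 1] `*` `[B, tau] : set (R * R)).
    by apply: compact_setX; exact: segment_compact.
  apply: (@subclosed_compact _ _ _ _ boxc); last by move=> p [].
  apply: closedI => //; apply: compact_closed boxc.
  exact: norm_hausdorff.
have [|||[m T]] := @compact_EVT_min _ _ (fun p : R * R => p.1) K.
- by exists (tau^-1, 0); exact: MK.
- exact: Kcpt.
- by apply: continuous_subspaceT.
move=> /set_mem [[m01 _] MmT] mmin; exists m; split; first by exists T.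
move=> m' [T' MmT'].
have [m'1|/ltW m'1] := leP m' 1.
  by apply: (mmin (m', T')); apply/mem_set/MK.
by apply: le_trans m'1; move: m01; rewrite /= in_itv /= => /andP[].
Qed.

End SkiRental.

(* Main.v *)
(**
Let [I l = E (min A l)] and [S l = P (A >= l)].  The expected cost of a season
of length [l] is [I l + 1 - S l], and [I] is nonnegative with
[(b - a) * S b <= I b - I a].  A cost bound [g] thus reads [I' >= I + 1 - g],
so on each interval where [g] is affine [I] dominates, by a discrete Gronwall
argument, the solution [J] of [J' = J + 1 - g] with the same initial value.
Conversely, the cost bound at [a + 1] forces [I a <= g (a + 1) - 1].

For [tau <= 1], following [I] along [0, tau, 1] gives one branch of [mu_le1],
and following it along [tau, 1] after [I tau >= tau * S tau] gives the other.
For [tau > 1], set [s = min (S tau) m].  Then [I tau <= rho - 1 + s], and [I]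
lies above the line of slope [s] that starts at [(T, J T)].  Choosing [T] with
[J' T = s], clipped at [0], shows [(m, T)] to lie in [M tau rho].
*)
Require Import Defs.
From HB Require Import structures.
From mathcomp Require Import all_boot all_order all_algebra.
From mathcomp Require Import all_classical all_reals all_analysis.
From mathcomp Require Import measurable_realfun.
From mathcomp Require Import ring lra.
Import Order.TTheory GRing.Theory Num.Theory.
Import numFieldNormedType.Exports.
Local Open Scope classical_set_scope.
Local Open Scope ring_scope.

(** * Survival profiles and the discrete Gronwall argument *)

(** Over [n.+1] equal steps the losses add up to at most [K * (b - a) ^+ 2 / n.+1%:R], which is
    arbitrarily small. *)
Lemma quadratic_decrease_nondecreasing {R : realType} {phi : R -> R} (K : R)
    {a b : R} :
  a <= b ->
  (forall x y, a <= x -> x <= y -> y <= b ->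
     phi x - phi y <= K * (y - x) ^+ 2) ->
  phi a <= phi b.
Proof.
move=> ab H.
have Hn n : (phi a - phi b) * n.+1%:R <= K * (b - a) ^+ 2.
  pose h := (b - a) / n.+1%:R.
  have n0 : 0 < n.+1%:R :> R by rewrite ltr0n.
  have h0 : 0 <= h by rewrite divr_ge0 ?subr_ge0 // ltW.
  have hn : h * n.+1%:R = b - a by rewrite /h divfK // gt_eqF.
  have step k : (k <= n.+1)%N ->
      phi a - phi (a + h * k%:R) <= K * h ^+ 2 * k%:R.
    elim: k => [|k IH] kn; first by rewrite !mulr0 addr0 subrr.
    have := IH (ltnW kn).
    have k0 : 0 <= h * k%:R by rewrite mulr_ge0.
    have kS : k.+1%:R = k%:R + 1 :> R by rewrite -natr1.
    have knR : h * k.+1%:R <= h * n.+1%:R by rewrite ler_wpM2l // ler_nat.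
    have := H (a + h * k%:R) (a + h * k.+1%:R).
    rewrite kS in knR *.
    have -> : a + h * (k%:R + 1) - (a + h * k%:R) = h by ring.
    by move=> st IH'; have := st ltac:(lra) ltac:(lra) ltac:(lra); lra.
  have := step n.+1 (leqnn _).
  rewrite hn (_ : a + (b - a) = b); last by ring.
  move=> le1; apply: (@le_trans _ _ (K * h ^+ 2 * n.+1%:R * n.+1%:R)).
    by rewrite ler_wpM2r // ltW.
  by rewrite -hn; rewrite !expr2; lra.
rewrite leNgt; apply/negP => lt_ba.
have d0 : 0 < phi a - phi b by rewrite subr_gt0.
have := truncnS_gt (K * (b - a) ^+ 2 / (phi a - phi b)).
by rewrite ltr_pdivrMr // [ltRHS]mulrC ltNge Hn.
Qed.

Definition survival_profile {R : realType} (I S : R -> R) : Prop :=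
  [/\ forall l, 0 <= l -> 0 <= I l, forall l, 0 <= S l
    & forall a b, 0 <= a -> a <= b -> (b - a) * S b <= I b - I a].

(** Integrate two pointwise facts: the cost is [min A l] plus the indicator of [A < l], and
    [min A b - min A a] is at least [b - a] where [A >= b]. *)
Lemma expected_cost_profile (R : realType) (d : measure_display)
    (Omega : measurableType d) (P : probability Omega R) (A : Omega -> \bar R) :
  measurable_fun [set: Omega] A -> (forall w, (0%:E <= A w)%E) ->
  exists I S : R -> R, survival_profile I S /\
    forall l, 0 <= l -> expected_cost P A l = (I l + 1 - S l)%:E.
Proof.
move=> mA A0.
pose U (l : R) := [set w | (l%:E <= A w)%E].
have mU l : measurable (U l).
  by rewrite -[U l]setTI; exact: emeasurable_fun_c_infty.
pose m (l : R) w := mine (A w) l%:E.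
have mm l : measurable_fun setT (m l) by apply: measurable_mine.
have m0 l w : 0 <= l -> (0 <= m l w)%E by move=> l0; rewrite le_min A0 lee_fin.
have mfin l : 0 <= l -> (\int[P]_w m l w)%E \is a fin_num.
  move=> l0; rewrite ge0_fin_numE; last by apply: integral_ge0 => w _; exact: m0.
  apply: (@le_lt_trans _ _ (\int[P]_w (cst l%:E w))%E).
    apply: ge0_le_integral => //.
    - by move=> w _; exact: m0.
    - by move=> w _; rewrite ge_min lexx orbT.
  by rewrite integral_cst // [X in (_ * X)%E](@probability_setT _ _ _ P) mule1 ltry.
have Pfin l : P (U l) \is a fin_num by exact: fin_num_measure.
have m1 (B : set Omega) : measurable B ->
    measurable_fun setT (fun w => (\1_B w)%:E : \bar R).
  by move=> mB; apply/measurable_EFinP; exact: measurable_indic.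
exists (fun l => fine (\int[P]_w m l w)%E), (fun l => fine (P (U l))).
split; first split.
- by move=> l l0; apply/fine_ge0/integral_ge0 => w _; exact: m0.
- by move=> l; exact/fine_ge0/measure_ge0.
- move=> a b a0 ab; have b0 := le_trans a0 ab.
  rewrite lerBrDr -lee_fin EFinD EFinM !fineK ?mfin // -[U b]setIT.
  rewrite -integral_indic // -ge0_integralZl_EFin ?subr_ge0 //; last exact: m1.
  have ge0_ind w : (0 <= (b - a)%:E * (\1_(U b) w)%:E :> \bar R)%E.
    by rewrite mule_ge0 ?lee_fin ?subr_ge0.
  have m_ind := measurable_funeM (b - a)%:E (m1 _ (mU b)).
  rewrite -ge0_integralD //; last by move=> w _; exact: m0.
  apply: ge0_le_integral => //.
  - by move=> w _; rewrite adde_ge0 ?m0.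
  - exact: emeasurable_funD.
  move=> w _; rewrite /m indicE.
  have [bA|Ab] := leP b%:E (A w).
    rewrite mem_set // mule1 (_ : b%:E = (b - a)%:E + a%:E)%E; last first.
      by rewrite -EFinD subrK.
    by rewrite leeD2l // ge_min lexx orbT.
  rewrite memNset ?mule0 ?add0e; last by apply/negP; rewrite -ltNge.
  by rewrite ge_min lexx.
- move=> l l0.
  rewrite EFinB EFinD !fineK ?mfin // -addeA.
  rewrite -(probability_setC P (mU l)).
  rewrite -[~` U l]setIT -integral_indic //; last exact: measurableC.
  rewrite -ge0_integralD //; [|by move=> w _; exact: m0|by apply: m1; exact: measurableC].
  apply: eq_integral => w _.
  rewrite /ski_cost /m indicE.
  case: (ltP (A w) l%:E) => Al.
    rewrite mem_set /=; first by rewrite addeC.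
    by apply/negP; rewrite -ltNge.
  rewrite memNset /=; first by rewrite adde0.
  by move=> /(_ Al).
Qed.

(* For an affine cost bound [p + q * t], the affine function
   [(p + q - 1) + q * t] solves [J + 1 - J' = p + q * t]; the excess of [I]
   over it then satisfies [D' >= D]. *)
Definition excess {R : realType} (I : R -> R) (p q t : R) : R :=
  I t - (p + q - 1) - q * t.

(** With [h = y - x], the profile inequality and the cost bound at [y] give [D x <= (1 - h) * D y]
    for the excess [D]. Replacing [1 - h] by [expR (- h)] costs only a multiple of [h ^+ 2]. *)
Lemma excess_expR_nondecreasing {R : realType} {I S : R -> R} {p q a b : R} :
  survival_profile I S -> 0 <= a -> a <= b ->
  (forall t, a <= t -> t <= b -> I t + 1 - S t <= p + q * t) ->
  excess I p q a * expR (- a) <= excess I p q b * expR (- b).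
Proof.
move=> [I0 _ IS] a0 ab cost_le.
(* As [I] is nonnegative, [- K] bounds the excess from below on the interval; this is the only side
   needed, since [expR (- h) >= 1 - h]. *)
pose K := `|p + q - 1| + `|q| * b.
apply: (@quadratic_decrease_nondecreasing _
  (fun t => excess I p q t * expR (- t)) K) => // x y ax xy yb.
have step : excess I p q x <= (1 - (y - x)) * excess I p q y.
  have h1 := IS x y (le_trans a0 ax) xy.
  have h2 := cost_le y (le_trans ax xy) yb.
  have h3 : (y - x) * (I y + 1 - (p + q * y)) <= (y - x) * S y.
    by apply: ler_wpM2l; lra.
  rewrite /excess; lra.
have y0 : 0 <= y by lra.
have DK : - K <= excess I p q y.
  have := I0 y y0; have := ler_norm (p + q - 1).
  have : q * y <= `|q| * b.
    by apply: (le_trans (ler_norm _)); rewrite normrM (ger0_norm y0) ler_wpM2l.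
  rewrite /excess /K; lra.
have K0 : 0 <= K by rewrite addr_ge0 // mulr_ge0 //; lra.
set h := y - x in step *.
have h0 : 0 <= h by rewrite /h; lra.
have -> : expR (- y) = expR (- x) * expR (- h).
  by rewrite -expRD; congr expR; rewrite /h; ring.
have ex0 := expR_gt0 (- x); have eh0 := expR_gt0 (- h).
have ex1 : expR (- x) <= 1 by rewrite -expR0 ler_expR; lra.
have eh1 : 1 - h <= expR (- h) by exact: expR_ge1Dx.
have eh2 : expR (- h) * (1 + h) <= 1.
  have eE : expR (- h) * expR h = 1 by rewrite -expRD addNr expR0.
  rewrite -[leRHS]eE.
  by apply: ler_wpM2l; [exact: ltW|exact: expR_ge1Dx].
have eh3 : expR (- h) - (1 - h) <= h ^+ 2.
  by rewrite expr2; nra.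
have main : excess I p q x - expR (- h) * excess I p q y <= K * h ^+ 2.
  have : (expR (- h) - (1 - h)) * (- K) <= (expR (- h) - (1 - h)) * excess I p q y.
    by apply: ler_wpM2l => //; lra.
  have : (expR (- h) - (1 - h)) * K <= h ^+ 2 * K by apply: ler_wpM2r.
  lra.
have K2 : 0 <= K * h ^+ 2 by rewrite mulr_ge0 ?sqr_ge0.
have := ler_wpM2l (ltW ex0) main.
have := ler_wpM2r K2 ex1.
lra.
Qed.

(* A season ending at [a + 1] costs at least [I a + 1]. *)
Lemma profile_le_cost_succ {R : realType} {I S : R -> R} {g a : R} :
  survival_profile I S -> 0 <= a -> I (a + 1) + 1 - S (a + 1) <= g ->
  I a <= g - 1.
Proof.
move=> [_ _ IS] a0.
by have := IS a (a + 1) a0 ltac:(lra); lra.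
Qed.

(** * Lower bounds on [m] for competitive profiles *)

Definition competitive {R : realType} (I S : R -> R) (rho tau m : R) : Prop :=
  forall l, 0 <= l ->
    I l + 1 - S l <= rho * Num.min l 1 + m * `|tau - l|.

Lemma competitive_mu_le1 (R : realType) (I S : R -> R) (rho tau m : R) :
  survival_profile I S -> competitive I S rho tau m ->
  1 <= rho -> 0 <= tau -> tau <= 1 -> mu_le1 tau rho <= m.
Proof.
move=> prof cost_le rho1 tau0 tau1.
have [I0 S0 IS] := prof.
have e0 := expR_gt0 (1 : R); have et0 := expR_gt0 tau.
have etN : expR (- tau) * expR tau = 1 by rewrite -expRD addNr expR0.
have I1 : I 1 <= rho + m * (2 - tau) - 1.
  apply: (profile_le_cost_succ prof) => //.
  have := cost_le (1 + 1) ltac:(lra).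
  rewrite (min_r (_ : 1 <= 1 + 1)); last lra.
  by rewrite ler0_norm; lra.
have D2 : excess I (- (m * tau)) (rho + m) tau * expR (- tau) <=
          excess I (- (m * tau)) (rho + m) 1 * expR (- 1).
  apply: (excess_expR_nondecreasing prof) => // t taut t1.
  have := cost_le t ltac:(lra).
  by rewrite (min_l t1) ler0_norm; lra.
rewrite /mu_le1; case: ifPn => [cond|_].
  have {}tau1 : tau < 1.
    (* At [tau = 1] the branch condition reads [0 > 2 - 2 / rho], which [1 <= rho] excludes. *)
    rewrite lt_neqAle tau1 andbT; apply/eqP => tau1'.
    move: cond; rewrite tau1' subrr mul0r subr_lt0 ltr_pdivlMr; lra.
  have := cost_le tau tau0; rewrite min_l ?(ltW tau1) // subrr normr0 mulr0 => It.
  have := IS 0 tau (lexx _) tau0; have := I0 0 (lexx _) => I00 Iconc.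
  have eE : expR (tau - 1) = expR tau * expR (- 1) by rewrite -expRD.
  (* Eliminates [S tau] between the cost bound at [tau] and [tau * S tau <= I tau]. *)
  have : tau * (1 - rho * tau) <= (1 - tau) * I tau by nra.
  have : I tau <= rho * (tau + 1 - expR (tau - 1)) + m - 1.
    have X1 : excess I (- (m * tau)) (rho + m) 1 * expR (- 1) <= - rho * expR (- 1).
      by apply: ler_wpM2r; [exact/ltW/expR_gt0|rewrite /excess; lra].
    have := ler_wpM2r (ltW et0) (le_trans D2 X1).
    by rewrite eE -mulrA etN mulr1 /excess; lra.
  move=> h1 h2.
  have d0 : 0 < 1 - tau by lra.
  suff : (rho * expR (tau - 1) - m) * (1 - tau) <= rho - 1.
    rewrite -ler_pdivlMr //; lra.
  have := ler_wpM2l (ltW d0) h1; lra.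
have D1 : excess I (m * tau) (rho - m) 0 * expR (- 0) <=
          excess I (m * tau) (rho - m) tau * expR (- tau).
  apply: (excess_expR_nondecreasing prof) => // t t0 ttau.
  have := cost_le t t0.
  by rewrite min_l ?ger0_norm; lra.
have den : 0 < 2 - (1 - tau) * expR tau.
  have : 1 + - tau <= expR (- tau) by exact: expR_ge1Dx.
  nra.
rewrite ler_pdivrMr //.
have -> : (expR 1 - 1) / expR 1 = 1 - expR (- 1) :> R.
  by rewrite expRN; field; rewrite gt_eqF.
have := I0 0 (lexx _).
move: D1 D2; rewrite /excess oppr0 expR0 !mulr1 !mulr0 !subr0 => D1 D2 I00.
have I1e := ler_wpM2r (ltW (expR_gt0 (- 1))) I1.
(* [I tau * expR (- tau)] cancels when [D1] and [D2] are chained; [I 0] and [I 1] are replaced by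
   their bounds. *)
have fin : 1 - rho * (1 - expR (- 1)) <= m * (2 * expR (- tau) - (1 - tau)).
  lra.
have := ler_wpM2l (ltW et0) fin.
have -> : expR tau * (m * (2 * expR (- tau) - (1 - tau))) =
   m * (2 * (expR (- tau) * expR tau) - (1 - tau) * expR tau) by ring.
by rewrite etN mulr1.
Qed.

Lemma competitive_mu_gt1 (R : realType) (I S : R -> R) (rho tau m : R) :
  survival_profile I S -> competitive I S rho tau m ->
  1 <= rho -> 1 < tau -> mu_gt1 tau rho <= m.
Proof.
move=> prof cost_le rho1 tau1.
have [I0 S0 IS] := prof.
have [_ mu_min] := mu_gt1P tau1 rho1.
have tail a : tau <= a -> I a <= rho + m * (a + 1 - tau) - 1.
  move=> taua; apply: (profile_le_cost_succ prof); first lra.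
  have := cost_le (a + 1) ltac:(lra).
  by rewrite min_r ?ler0_norm; lra.
have m0 : 0 <= m.
  rewrite leNgt; apply/negP => m0.
  (* At [a = tau + rho / - m] the bound [tail] equals [m - 1 < 0], contradicting [I >= 0]. *)
  have mV : m * (rho / - m) = - rho by field; rewrite lt_eqF.
  have rV : 0 <= rho / - m by rewrite divr_ge0; lra.
  have := tail (tau + rho / - m) ltac:(lra).
  by have := I0 (tau + rho / - m) ltac:(lra); lra.
have [mtau1|mtau1] := leP 1 (m * tau).
  (* The pair [(tau^-1, 0)] always lies in [M tau rho], which settles large [m]. *)
  apply: (@le_trans _ _ tau^-1); last by rewrite -div1r ler_pdivrMr; lra.
  apply: mu_min; exists 0.
  have tV : tau^-1 * tau = 1 by rewrite mulVf //; lra.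
  have tV0 : 0 < tau^-1 by rewrite invr_gt0; lra.
  by rewrite /M /= expR0 tV; split; nra.
apply: mu_min.
(* The bounds [0 <= s <= m] become the last two conditions of [M] once
   [c * expR T = rho - m - s]. *)
pose s := Num.min (S tau) m.
have s0 : 0 <= s by rewrite le_min S0.
have sS : s <= S tau by rewrite ge_min lexx.
have sm : s <= m by rewrite ge_min lexx orbT.
have Itau : I tau <= rho - 1 + s.
  have h1 := tail tau (lexx _).
  have := cost_le tau ltac:(lra).
  rewrite min_r ?subrr ?normr0; last lra.
  by rewrite /s; case: (leP (S tau) m) => _; lra.
set c := m * tau + rho - m - 1.
have mt : 0 <= m * (tau - 1) by rewrite mulr_ge0; lra.
have c0 : 0 <= c by rewrite /c; lra.
(* The left side is the solution [J] with [J 0 = 0]; its slope [rho - m - c * expR t] decreases from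
   [1 - m * tau] at 0 to [rho - m - c * expR 1] at 1. *)
have IJ t : 0 <= t -> t <= 1 -> c + (rho - m) * t - c * expR t <= I t.
  move=> t0 t1.
  have := @excess_expR_nondecreasing _ _ _ (m * tau) (rho - m) 0 t prof (lexx _) t0.
  have etN : expR (- t) * expR t = 1 by rewrite -expRD addNr expR0.
  rewrite oppr0 expR0 mulr1 => D.
  have {}D : excess I (m * tau) (rho - m) 0 <=
             excess I (m * tau) (rho - m) t * expR (- t).
    apply: D => u u0 ut; have := cost_le u u0.
    by rewrite min_l ?ger0_norm; lra.
  have := ler_wpM2r (ltW (expR_gt0 t)) D; rewrite -mulrA etN mulr1.
  have := mulr_ge0 (I0 0 (lexx _)) (ltW (expR_gt0 t)).
  by rewrite /excess /c; lra.
have line t : 0 <= t -> t <= 1 -> I t + (tau - t) * s <= I tau.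
  move=> t0 t1; have := IS t tau t0 ltac:(lra).
  have : (tau - t) * s <= (tau - t) * S tau by rewrite ler_wpM2l; lra.
  lra.
have [sB|sB] := leP (1 - m * tau) s.
  exists 0; rewrite /M /= expR0 mulr1 -/c.
  have := line 0 (lexx _) ltac:(lra); have := I0 0 (lexx _).
  have : (tau - 1) * (1 - m * tau) <= (tau - 1) * s by rewrite ler_wpM2l; lra.
  by move=> *; split; rewrite /c; lra.
have [sC|sC] := ltP s (rho - m - c * expR 1).
  have D3 : excess I (rho + m * tau) (- m) 1 * expR (- 1) <=
            excess I (rho + m * tau) (- m) tau * expR (- tau).
    apply: (excess_expR_nondecreasing prof); [lra..|] => t t1 ttau.
    have := cost_le t ltac:(lra).
    by rewrite min_r ?ger0_norm; lra.
  (* Growth along [[1, tau]] forces [(rho - c * expR 1) * tau <= s + m], whereas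
     [s + m < rho - c * expR 1] and [tau > 1]. *)
  exfalso.
  have E : tau <= expR (tau - 1) by have := expR_ge1Dx (tau - 1); lra.
  have etN : expR (- tau) * expR tau = 1 by rewrite -expRD addNr expR0.
  have := ler_wpM2r (ltW (expR_gt0 tau)) D3; rewrite -mulrA -mulrA etN mulr1.
  rewrite -expRD (addrC (- 1)).
  have I1 := IJ 1 ltac:(lra) (lexx _).
  have X1 : rho - c * expR 1 <= excess I (rho + m * tau) (- m) 1.
    by rewrite /excess /c in I1 *; lra.
  have : (rho - c * expR 1) * tau <= excess I (rho + m * tau) (- m) 1 * expR (tau - 1).
    by apply: ler_pM => //; lra.
  have : 0 < (rho - c * expR 1) * (tau - 1) by rewrite mulr_gt0; lra.
  by rewrite /excess; rewrite /c in sC *; lra.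
have c_gt0 : 0 < c.
  have : 0 < rho - m - s by rewrite /c in sB; lra.
  have := expR_gt0 (1 : R); nra.
(* [T = ln r] solves [J' T = s]; the two excluded cases place it in [[0, 1]], where [IJ] and [line]
   combine into the first condition of [M]. *)
pose r := (rho - m - s) / c.
have rc : c * r = rho - m - s by rewrite /r mulrC divfK // gt_eqF.
have r1 : 1 < r by rewrite /r ltr_pdivlMr // mul1r /c; lra.
have re : r <= expR 1 by rewrite /r ler_pdivrMr //; lra.
have r0 : r \is Num.pos by rewrite posrE; lra.
have T0 : 0 <= ln r by apply: ln_ge0; lra.
have T1 : ln r <= 1 by rewrite -ler_expR lnK.
exists (ln r); rewrite /M /= lnK // -/c -mulrA rc.
have lineT := line _ T0 T1; have := IJ _ T0 T1; rewrite lnK // rc /c => IJT.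
by split; lra.
Qed.

Theorem theorem22 (R : realType) (rho tau mu_hat : R)
    (hrho1 : 1 <= rho) (hrho2 : rho <= expR 1 / (expR 1 - 1))
    (htau : 0 <= tau) (hmu : mu_hat < mu tau rho)
    (d : measure_display) (Omega : measurableType d)
    (P : probability Omega R) (A : Omega -> \bar R)
    (mA : measurable_fun [set: Omega] A)
    (A_ge0 : forall w : Omega, (0%:E <= A w)%E) :
  exists l : R, 0 <= l /\
    ((rho * Num.min l 1 + mu_hat * `|tau - l|)%:E < expected_cost P A l)%E.
Proof.
have [I [S [prof costE]]] := expected_cost_profile R d Omega P A mA A_ge0.
apply: contrapT => no_l.
have cost_le : competitive I S rho tau mu_hat.
  move=> l l0; rewrite leNgt; apply/negP => lt_cost.
  by apply: no_l; exists l; rewrite costE // lte_fin.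
move: hmu; apply/negP; rewrite -leNgt /mu.
have [tau1|tau1] := leP tau 1.
- exact: competitive_mu_le1 prof cost_le hrho1 htau tau1.
- exact: competitive_mu_gt1 prof cost_le hrho1 tau1.
Qed.
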